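(* The 2-category of parasimplices $\underline\Lambda$ is adjunction complete, i.e. every 1-morphism $f$ in $\underline\Lambda$ admits both a right adjoint $\mathsf rf$ and a left adjoint $\mathsf lf$ in $\underline\Lambda$.
   Context: For $n\ge0$ the $n$-parasimplex $\Lambda_n$ is the linearly ordered set $\mathbb Z$ equipped with the $\mathbb Z$-action $(\lambda,m)\mapsto\lambda+(n+1)m$. The 2-category of parasimplices $\underline\Lambda$ has objects $\Lambda_n$ ($n\ge0$), 1-morphisms the $\mathbb Z$-equivariant order-preserving maps, and 2-morphisms the natural transformations (i.e. there is a unique 2-morphism $f\to g$ iff $f(\lambda)\le g(\lambda)$ for all $\lambda$). *)

(* Defs.v *)
From mathcomp Require Import all_boot all_order all_algebra.
From Stdlib Require Import FunctionalExtensionality.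

Set Implicit Arguments.
Unset Strict Implicit.
Unset Printing Implicit Defensive.

Import Order.TTheory GRing.Theory Num.Theory.
Local Open Scope ring_scope.

Declare Scope twocat_scope.
Delimit Scope twocat_scope with C2.

(* [comp1 g f] is "g after f", and likewise for [vcomp] and [hcomp]. *)
Record twocat_data := TwocatData {
  obj :> Type;
  hom1 : obj -> obj -> Type;
  hom2 : forall x y, hom1 x y -> hom1 x y -> Type;
  id1 : forall x, hom1 x x;
  comp1 : forall x y z, hom1 y z -> hom1 x y -> hom1 x z;
  id2 : forall x y (f : hom1 x y), hom2 f f;
  vcomp : forall x y (f g h : hom1 x y), hom2 g h -> hom2 f g -> hom2 f h;
  hcomp : forall x y z (f f' : hom1 x y) (g g' : hom1 y z),
    hom2 g g' -> hom2 f f' -> hom2 (comp1 g f) (comp1 g' f')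
}.

Arguments id1 {C} x : rename.
Arguments id2 {C x y} f : rename.

Notation "g '\o1' f" := (comp1 g f) (at level 50, left associativity)
  : twocat_scope.
Notation "b '\v' a" := (vcomp b a) (at level 50, left associativity)
  : twocat_scope.
Notation "b '\h' a" := (hcomp b a) (at level 45, left associativity)
  : twocat_scope.
Local Open Scope twocat_scope.

Definition cell_of_eq (C : twocat_data) (x y : C) (f g : hom1 x y)
    (e : f = g) : hom2 f g :=
  let: erefl := e in id2 f.

(* Strict 2-categories: 1-morphisms compose associatively and unitally on the
   nose.  Equations between 2-morphisms whose boundaries agree only up to these
   equalities are stated by inserting the 2-morphism [cell_of_eq e], which is
   an identity transported along e. *)
Record twocat := Twocat {
  twocat_base :> twocat_data;
  comp1A : forall (x y z w : twocat_base)
    (h : hom1 z w) (g : hom1 y z) (f : hom1 x y),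
    h \o1 (g \o1 f) = h \o1 g \o1 f;
  comp1_idl : forall (x y : twocat_base) (f : hom1 x y), id1 y \o1 f = f;
  comp1_idr : forall (x y : twocat_base) (f : hom1 x y), f \o1 id1 x = f;
  vcompA : forall (x y : twocat_base) (f g h k : hom1 x y)
    (c : hom2 h k) (b : hom2 g h) (a : hom2 f g),
    c \v (b \v a) = c \v b \v a;
  vcomp_idl : forall (x y : twocat_base) (f g : hom1 x y) (a : hom2 f g),
    id2 g \v a = a;
  vcomp_idr : forall (x y : twocat_base) (f g : hom1 x y) (a : hom2 f g),
    a \v id2 f = a;
  hcomp_id2 : forall (x y z : twocat_base) (g : hom1 y z) (f : hom1 x y),
    id2 g \h id2 f = id2 (g \o1 f);
  interchange : forall (x y z : twocat_base)
    (f f' f'' : hom1 x y) (g g' g'' : hom1 y z)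
    (b' : hom2 g' g'') (b : hom2 g g') (a' : hom2 f' f'') (a : hom2 f f'),
    (b' \v b) \h (a' \v a) = (b' \h a') \v (b \h a);
  hcompA : forall (x y z w : twocat_base)
    (h h' : hom1 z w) (g g' : hom1 y z) (f f' : hom1 x y)
    (c : hom2 h h') (b : hom2 g g') (a : hom2 f f'),
    cell_of_eq (comp1A h' g' f') \v (c \h (b \h a)) =
    (c \h b \h a) \v cell_of_eq (comp1A h g f);
  hcomp_idl : forall (x y : twocat_base) (f f' : hom1 x y) (a : hom2 f f'),
    cell_of_eq (comp1_idl f') \v (id2 (id1 y) \h a) =
    a \v cell_of_eq (comp1_idl f);
  hcomp_idr : forall (x y : twocat_base) (f f' : hom1 x y) (a : hom2 f f'),
    cell_of_eq (comp1_idr f') \v (a \h id2 (id1 x)) =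
    a \v cell_of_eq (comp1_idr f)
}.

Definition triangle_left (C : twocat) (x y : C) (l : hom1 x y) (r : hom1 y x)
    (eta : hom2 (id1 x) (r \o1 l)) (eps : hom2 (l \o1 r) (id1 y)) : Prop :=
  cell_of_eq (comp1_idl l) \v (eps \h id2 l) \v cell_of_eq (comp1A l r l)
    \v (id2 l \h eta) \v cell_of_eq (esym (comp1_idr l)) = id2 l.

Definition triangle_right (C : twocat) (x y : C) (l : hom1 x y) (r : hom1 y x)
    (eta : hom2 (id1 x) (r \o1 l)) (eps : hom2 (l \o1 r) (id1 y)) : Prop :=
  cell_of_eq (comp1_idr r) \v (id2 r \h eps) \v cell_of_eq (esym (comp1A r l r))
    \v (eta \h id2 r) \v cell_of_eq (esym (comp1_idl r)) = id2 r.

(* l is left adjoint to r *)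
Definition adjoint (C : twocat) (x y : C) (l : hom1 x y) (r : hom1 y x) : Prop :=
  exists (eta : hom2 (id1 x) (r \o1 l)) (eps : hom2 (l \o1 r) (id1 y)),
    triangle_left eta eps /\ triangle_right eta eps.

Definition adjunction_complete (C : twocat) : Prop :=
  forall (x y : C) (f : hom1 x y),
    (exists rf : hom1 y x, adjoint f rf) /\
    (exists lf : hom1 y x, adjoint lf f).

(* The n-parasimplex is int with its usual order and the following action. *)
Definition parasimplex_act (n : nat) (l m : int) : int := l + n.+1%:Z * m.

Record paramap (p q : nat) := Paramap {
  paramap_fun :> int -> int;
  paramap_homo : {homo paramap_fun : x y / x <= y};
  paramap_equivariant : forall l m : int,
    paramap_fun (parasimplex_act p l m) = parasimplex_act q (paramap_fun l) m
}.

Lemma paramap_eq (p q : nat) (f g : paramap p q) : f =1 g -> f = g.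
Proof.
case: f g => [f fh fe] [g gh ge] /= /functional_extensionality fg.
case: _ / fg in gh ge *; congr Paramap.
- do 3![apply: functional_extensionality_dep => ?]; exact: bool_irrelevance.
- do 2![apply: functional_extensionality_dep => ?]; exact: eq_irrelevance.
Qed.

Lemma paramap_id_equivariant (p : nat) (l m : int) :
  id (parasimplex_act p l m) = parasimplex_act p (id l) m.
Proof. by []. Qed.

Definition paramap_id (p : nat) : paramap p p :=
  @Paramap p p id (fun _ _ le_xy => le_xy) (@paramap_id_equivariant p).

Lemma paramap_comp_homo (p q r : nat) (g : paramap q r)
  (f : paramap p q) :
  {homo g \o f : x y / x <= y}.
Proof. by move=> x y le_xy; do 2!apply: paramap_homo. Qed.

Lemma paramap_comp_equivariant (p q r : nat) (g : paramap q r)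
  (f : paramap p q) (l m : int) :
  (g \o f) (parasimplex_act p l m) = parasimplex_act r ((g \o f) l) m.
Proof. by rewrite /= !paramap_equivariant. Qed.

Definition paramap_comp (p q r : nat) (g : paramap q r)
  (f : paramap p q) : paramap p r :=
  Paramap (paramap_comp_homo g f) (paramap_comp_equivariant g f).

(* A natural transformation between monotone maps, seen as functors between
   the posets; naturality squares commute automatically in a poset. *)
Definition paramap_le (p q : nat) (f g : paramap p q) : Prop :=
  forall l : int, f l <= g l.

Lemma paramap_le_irrelevance (p q : nat) (f g : paramap p q)
  (a b : paramap_le f g) : a = b.
Proof.
apply: functional_extensionality_dep => l; exact: bool_irrelevance.
Qed.

Lemma paramap_le_refl (p q : nat) (f : paramap p q) : paramap_le f f.
Proof. by move=> l. Qed.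

Lemma paramap_le_trans (p q : nat) (f g h : paramap p q) :
  paramap_le g h -> paramap_le f g -> paramap_le f h.
Proof. by move=> gh fg l; apply: le_trans (fg l) (gh l). Qed.

Lemma paramap_le_comp (p q r : nat) (f f' : paramap p q) (g g' : paramap q r) :
  paramap_le g g' -> paramap_le f f' ->
  paramap_le (paramap_comp g f) (paramap_comp g' f').
Proof.
by move=> gg' ff' l; apply: le_trans (gg' _); apply: paramap_homo (ff' l).
Qed.

(* The object n stands for the n-parasimplex. *)
Definition parasimplices_data : twocat_data :=
  @TwocatData nat paramap paramap_le paramap_id paramap_comp
    paramap_le_refl paramap_le_trans paramap_le_comp.

Definition parasimplices : twocat.
Proof.
by unshelve refine (@Twocat parasimplices_data _ _ _ _ _ _ _ _ _ _ _);
  move=> *; first [exact: paramap_eq | exact: paramap_le_irrelevance].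
Defined.

(* Main.v *)
Require Import Defs.
From mathcomp Require Import all_boot all_order all_algebra.
From mathcomp Require Import zify.

(* An adjunction between parasimplices is a Galois connection, and the adjoint
   of an equivariant map is automatically monotone and equivariant.  Since an
   equivariant map is unbounded in both directions, for each y there is z with
   f z <= y < f (z + 1); then z =: r y is the value of the right adjoint.  As the
   order is that of the integers, the left adjoint is y |-> r (y - 1) + 1. *)

Set Implicit Arguments.
Unset Strict Implicit.
Unset Printing Implicit Defensive.

Import Order.TTheory GRing.Theory Num.Theory.
Local Open Scope ring_scope.

(** Discrete intermediate value: walking right from [a] in unit steps, the first step that takes [f]
    above [y] is a crossing. *)
Lemma exists_crossing (f : int -> int) (y a : int) (n : nat) :
  f a <= y < f (a + n%:Z) -> exists z, f z <= y < f (z + 1).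
Proof.
elim: n a => [|n IHn] a.
  by rewrite addr0 => /andP[/le_lt_trans/[apply]]; rewrite ltxx.
case/andP=> fa_le lt_y; have [fa1_le|lt_fa1] := leP (f (a + 1)) y.
  by apply: (IHn (a + 1)); rewrite fa1_le -addrA -PoszD add1n.
by exists a; rewrite fa_le.
Qed.

Lemma paramap_crossing (p q : nat) (f : paramap p q) (y : int) :
  exists z, f z <= y < f (z + 1).
Proof.
pose k := (`|f 0| + `|y|)%N.
have fE m : f (p.+1%:Z * m) = f 0 + q.+1%:Z * m.
  by have := paramap_equivariant f 0 m; rewrite /parasimplex_act add0r.
(* The endpoints are the translates of 0 by [- k] and [k.+1]. As [k] bounds [f 0] and [y] together,
   [f] is at most [y] at the first; the extra 1 makes the second inequality strict. *)
apply: (@exists_crossing f y (p.+1%:Z * - k%:Z) (p.+1 * (k + k.+1))%N).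
have -> : p.+1%:Z * - k%:Z + (p.+1 * (k + k.+1))%N%:Z = p.+1%:Z * k.+1%:Z by nia.
have le_qm (m : nat) : m%:Z <= q.+1%:Z * m%:Z by nia.
have ky : `|f 0| + `|y| <= k%:Z by rewrite PoszD !abszE.
move: (le_qm k) (le_qm k.+1); rewrite !fE mulrN; clearbody k.
move: (q.+1%:Z * k%:Z) (q.+1%:Z * k.+1%:Z) => qk qk1 le_k le_k1.
by apply/andP; split; lia.
Qed.

(** By monotonicity the crossing is unique: it is the largest [z] with [f z <= y]. *)
Definition radj_fun (p q : nat) (f : paramap p q) (y : int) : int :=
  xchoose (paramap_crossing f y).

Lemma radj_galois (p q : nat) (f : paramap p q) (x y : int) :
  (f x <= y) = (x <= radj_fun f y).
Proof.
have /andP[le_y lt_y] := xchooseP (paramap_crossing f y).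
apply/idP/idP => [fx_le|le_x]; last exact: le_trans (paramap_homo f le_x) le_y.
(* Otherwise [radj_fun f y + 1 <= x], so [y < f (radj_fun f y + 1) <= f x]. *)
rewrite leNgt -lezD1; apply/negP => /(paramap_homo f) le_fx.
by have := lt_le_trans lt_y (le_trans le_fx fx_le); rewrite ltxx.
Qed.

Lemma radj_homo (p q : nat) (f : paramap p q) :
  {homo radj_fun f : x y / x <= y}.
Proof.
by move=> x y le_xy; rewrite -radj_galois (le_trans _ le_xy) // radj_galois.
Qed.

(** Both sides have the same lower bounds: acting by [- m] undoes acting by [m], and [f] commutes
    with it. *)
Lemma radj_equivariant (p q : nat) (f : paramap p q) (l m : int) :
  radj_fun f (parasimplex_act q l m) = parasimplex_act p (radj_fun f l) m.
Proof.
have actK n x y k :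
    (x <= parasimplex_act n y k) = (parasimplex_act n x (- k) <= y).
  by rewrite /parasimplex_act mulrN lerBlDr.
have le_radj x : (x <= radj_fun f (parasimplex_act q l m)) =
                 (x <= parasimplex_act p (radj_fun f l) m).
  by rewrite -radj_galois !actK -paramap_equivariant radj_galois.
by apply/le_anti; rewrite -le_radj lexx le_radj lexx.
Qed.

Definition radj (p q : nat) (f : paramap p q) : paramap q p :=
  Paramap (radj_homo f) (radj_equivariant f).

Definition ladj_fun (p q : nat) (f : paramap p q) (y : int) : int :=
  radj f (y - 1) + 1.

(** Negate [radj_galois] at [y - 1], turning strict inequalities into shifts by 1. *)
Lemma ladj_galois (p q : nat) (f : paramap p q) (x y : int) :
  (ladj_fun f y <= x) = (y <= f x).
Proof. by rewrite lezD1 ltNge -radj_galois -ltNge -lezD1 subrK. Qed.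

Lemma ladj_homo (p q : nat) (f : paramap p q) :
  {homo ladj_fun f : x y / x <= y}.
Proof. by move=> x y le_xy; rewrite lerD2r paramap_homo // lerD2r. Qed.

Lemma ladj_equivariant (p q : nat) (f : paramap p q) (l m : int) :
  ladj_fun f (parasimplex_act q l m) = parasimplex_act p (ladj_fun f l) m.
Proof.
have actD n x c : parasimplex_act n x m + c = parasimplex_act n (x + c) m.
  by rewrite /parasimplex_act addrAC.
by rewrite /ladj_fun actD paramap_equivariant actD.
Qed.

Definition ladj (p q : nat) (f : paramap p q) : paramap q p :=
  Paramap (ladj_homo f) (ladj_equivariant f).

(** Unit and counit come from [l x <= l x] and [r y <= r y]; the triangle identities hold because
    parallel 2-morphisms are equal. *)
Lemma adjoint_galois (p q : nat) (l : paramap p q) (r : paramap q p) :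
  (forall x y, (l x <= y) = (x <= r y)) -> @adjoint parasimplices p q l r.
Proof.
move=> lr.
have eta : paramap_le (paramap_id p) (paramap_comp r l) by move=> x; rewrite /= -lr.
have eps : paramap_le (paramap_comp l r) (paramap_id q) by move=> y; rewrite /= lr.
by exists eta, eps; split; apply: paramap_le_irrelevance.
Qed.

Theorem proposition3p10 : adjunction_complete parasimplices.
Proof.
move=> p q f; split.
  by exists (radj f); apply: adjoint_galois; apply: radj_galois.
by exists (ladj f); apply: adjoint_galois => y x; apply: ladj_galois.
Qed.
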